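(* Let $A$ be a $C^*$-algebra and let $a$ be a normal element of $A$ with finite spectrum. If $b\in A$, then $d(a,b)=0$ if and only if $a-b$ is quasinilpotent and $a$ commutes with $b$.
   Context: All algebras are over $\mathbb{C}$ and have a unit $1$; $\sigma(x)$ is the spectrum of $x\in A$, and $x$ is quasinilpotent if $\sigma(x)=\{0\}$. For $a,b\in A$ let $C_{a,b}:A\to A$ be the bounded operator $C_{a,b}x=ax-xb$, put $\rho(a,b)=\limsup_{n\to\infty}\|C_{a,b}^n1\|^{1/n}$ and $d(a,b)=\max\{\rho(a,b),\rho(b,a)\}$. *)

(* Defs.v *)
From HB Require Import structures.
From mathcomp Require Import all_boot all_order all_algebra.
From mathcomp Require Import all_classical all_reals all_analysis.
From mathcomp Require Import complex.

Set Implicit Arguments.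
Unset Strict Implicit.
Unset Printing Implicit Defensive.

Import Order.TTheory GRing.Theory Num.Theory.
Import numFieldNormedType.Exports.

Local Open Scope classical_set_scope.
Local Open Scope ring_scope.
Local Open Scope complex_scope.

(* An HB structure joining [CompleteNormedModule] and [GRing.Algebra] is
   rejected: [Num.NumDomain] already lies below both [GRing.PzSemiRing] and
   [Num.SemiNormedZmodule] without a declared join. Hence plain records, with
   the library structures attached to the carrier. *)
Record banachAlg (K : numFieldType) := BanachAlg {
  banach_base : completeNormedModType K;
  banach_one : banach_base;
  banach_mul : banach_base -> banach_base -> banach_base;
  banach_mulA : associative banach_mul;
  banach_mul1r : left_id banach_one banach_mul;
  banach_mulr1 : right_id banach_one banach_mul;
  banach_mulDl : left_distributive banach_mul +%R;
  banach_mulDr : right_distributive banach_mul +%R;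
  banach_oner_neq0 : banach_one != 0;
  banach_scaleAl : forall (k : K) (x y : banach_base),
    k *: banach_mul x y = banach_mul (k *: x) y;
  banach_scaleAr : forall (k : K) (x y : banach_base),
    k *: banach_mul x y = banach_mul x (k *: y);
  banach_normM_le : forall x y : banach_base,
    `|banach_mul x y| <= `|x| * `|y|
}.

Definition banach_sort (K : numFieldType) (A : banachAlg K) : Type :=
  banach_base A.
Coercion banach_sort : banachAlg >-> Sortclass.

Section BanachAlgebraInstances.
Variables (K : numFieldType) (A : banachAlg K).

HB.instance Definition _ :=
  CompleteNormedModule.copy (banach_sort A) (banach_base A).
HB.instance Definition _ := GRing.Zmodule_isNzRing.Build (banach_sort A)
  (@banach_mulA K A) (@banach_mul1r K A) (@banach_mulr1 K A)
  (@banach_mulDl K A) (@banach_mulDr K A) (@banach_oner_neq0 K A).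
HB.instance Definition _ :=
  GRing.Lmodule_isLalgebra.Build K (banach_sort A) (@banach_scaleAl K A).
HB.instance Definition _ :=
  GRing.Lalgebra_isAlgebra.Build K (banach_sort A) (@banach_scaleAr K A).

End BanachAlgebraInstances.

Record cstarAlg (K : numClosedFieldType) := CStarAlg {
  cstar_base :> banachAlg K;
  star : cstar_base -> cstar_base;
  starK : involutive star;
  starD : forall x y : cstar_base, star (x + y) = star x + star y;
  starZ : forall (k : K) (x : cstar_base),
    star (k *: x) = Num.conj k *: star x;
  starM : forall x y : cstar_base, star (x * y) = star y * star x;
  norm_starM : forall x : cstar_base, `|star x * x| = `|x| ^+ 2
}.

Definition normal_elt (K : numClosedFieldType) (A : cstarAlg K) (x : A) :
  Prop := GRing.comm x (star x).

Definition invertible (A : nzRingType) (x : A) : Prop :=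
  exists y : A, y * x = 1 /\ x * y = 1.

Definition spectrum (K : numFieldType) (A : algType K) (x : A) : set K :=
  [set z | ~ invertible (z%:A - x)].

Definition quasinilpotent (K : numFieldType) (A : algType K) (x : A) : Prop :=
  spectrum x = [set 0].

Section Distance.
Variables (R : realType) (A : banachAlg R[i]).

Definition commutator_op (a b : A) : A -> A := fun x => a * x - x * b.

(* The norm of [A] takes its values in [R[i]], so its real part is taken. *)
Definition rho (a b : A) : \bar R :=
  limn_esup (fun n : nat =>
    (complex.Re `|iter n (commutator_op a b) 1| `^ n%:R^-1)%:E).

Definition dist_ab (a b : A) : \bar R := maxe (rho a b) (rho b a).

End Distance.

(* Main.v *)
Require Import Defs.
From HB Require Import structures.
From mathcomp Require Import all_boot all_order all_algebra.
From mathcomp Require Import all_classical all_reals all_analysis.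
From mathcomp Require Import cyclic separable cyclotomic.
From mathcomp Require Import complex ring lra.
Import Order.TTheory GRing.Theory Num.Theory.
Import numFieldNormedType.Exports.
Local Open Scope classical_set_scope.
Local Open Scope ring_scope.
Local Open Scope complex_scope.

Set Implicit Arguments.
Unset Strict Implicit.
Unset Printing Implicit Defensive.

(** Write C_{a,b} for the operator sending x to a x - x b. Everything is phrased
with root-null sequences: those whose n-th root of the norm tends to 0, that is,
sequences eventually below e^n for every e > 0. The vanishing of d(a,b) says
that both C_{a,b}^n 1 and C_{b,a}^n 1 are root-null [dist_ab_eq0].

If a and b commute, C_{a,b}^n 1 = (a - b)^n, and the claim becomes the fact that
an element is quasinilpotent if and only if its powers are root-null
[quasinilpotentP]. One half is the Neumann series. The other half, usually drawn
from Cauchy estimates, is obtained here from averages over roots of unity: the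
mean of (1 - w^k l x)^-1 over the n-th roots of unity w^k is the inverse of
1 - (l x)^n. The resolvent is bounded and Lipschitz on a disc, hence so are
these means, uniformly in n; so the property (t x)^n -> 0 propagates from t to
t + h with a step h that is constant on bounded intervals
[powers_vanish_step, powers_vanish_all].

What remains is that d(a,b) = 0 forces a and b to commute. Let the list s
contain the spectrum of the normal element a. The normal element w, the product
of the a - l for l in s, has no spectrum outside 0, so its powers are root-null;
since the norm of w^(2^k) is the 2^k-th power of the norm of w, it follows that
w = 0 [normal_finite_spectrum_annul]. Lagrange interpolation then gives elements
p_l with sum 1 and a p_l = p_l a = l p_l. Multiplying by p_l turns the
commutator iterates into powers: p_l C_{a,b}^n 1 = p_l (l - b)^n, and
C_{b,a}^n 1 p_m = (b - m)^n p_m, so both right-hand sides are root-null. For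
l <> m, the scalar l - m is the sum of l - b and b - m, and expanding
(l - m)^N p_l b p_m by the binomial theorem shows that p_l b p_m = 0
[root_null_mulr_eq0]; this replaces the usual appeal to Liouville's theorem for
the function p_l (z - b)^-1 p_m. So b is block diagonal with respect to the p_l
and commutes with a [root_null_comm]. *)

(** * Real-valued norms *)

Section RealNorm.
Variables (R : realType) (V : normedZmodType R[i]).
Implicit Types u v : V.

(** The norm takes values in [R[i]], where the order is partial; estimates are
carried out on its real part. The same function serves for scalars, as [R[i]] is
itself a normed module. *)
Definition nrm v : R := complex.Re `|v|.

Lemma nrmE v : (nrm v)%:C = `|v|.
Proof. exact: RRe_real (normr_real v). Qed.

Lemma nrm_ge0 v : 0 <= nrm v.
Proof. by rewrite -lecR nrmE; exact: normr_ge0. Qed.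

Lemma nrmD u v : nrm (u + v) <= nrm u + nrm v.
Proof. by rewrite -lecR rmorphD/= !nrmE; exact: ler_normD. Qed.

Lemma nrmN v : nrm (- v) = nrm v.
Proof. by rewrite /nrm normrN. Qed.

Lemma nrm0 : nrm (0 : V) = 0.
Proof. by rewrite /nrm normr0. Qed.

Lemma nrm_eq0 v : nrm v = 0 -> v = 0.
Proof. by move=> v0; apply/eqP; rewrite -normr_eq0 -nrmE v0. Qed.

Lemma nrmB u v : nrm (u - v) <= nrm u + nrm v.
Proof. by rewrite -(nrmN v) nrmD. Qed.

Lemma nrm_sum (I : Type) (s : seq I) (f : I -> V) :
  nrm (\sum_(i <- s) f i) <= \sum_(i <- s) nrm (f i).
Proof.
elim/big_ind2: _ => //; first by rewrite nrm0.
by move=> u x v y ux vy; apply: le_trans (nrmD _ _) (lerD _ _).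
Qed.

End RealNorm.

Section BanachNorm.
Variables (R : realType) (A : banachAlg R[i]).
Implicit Types x y : A.

Lemma nrmM x y : nrm (x * y) <= nrm x * nrm y.
Proof. by rewrite -lecR rmorphM/= !nrmE; exact: banach_normM_le. Qed.

Lemma nrmZ (k : R[i]) x : nrm (k *: x) = nrm k * nrm x.
Proof. by apply: complexI; rewrite rmorphM/= !nrmE normrZ. Qed.

Lemma nrmX_le x n : nrm (x ^+ n) <= nrm (1 : A) * nrm x ^+ n.
Proof.
elim: n => [|n IH]; first by rewrite !expr0 mulr1.
rewrite exprSr [in leRHS]exprSr mulrA.
by apply: le_trans (nrmM _ _) _; rewrite ler_wpM2r ?nrm_ge0.
Qed.

Lemma nrm1_gt0 : 0 < nrm (1 : A).
Proof.
rewrite lt_neqAle nrm_ge0 andbT eq_sym; apply/eqP => /nrm_eq0 /eqP.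
by rewrite oner_eq0.
Qed.
End BanachNorm.

Lemma nrmCM (R : realType) (k l : R[i]) : nrm (k * l) = nrm k * nrm l.
Proof. by apply: complexI; rewrite rmorphM/= !nrmE normrM. Qed.

Lemma nrm_Complex_le (R : realType) (s t : R) :
  nrm (s +i* t : R[i]) <= `|s| + `|t|.
Proof.
rewrite -[leRHS]ger0_norm ?addr_ge0// -sqrtr_sqr /nrm normc_def/=.
apply: ler_wsqrtr.
rewrite -(real_normK (num_real s)) -(real_normK (num_real t)).
by have := normr_ge0 s; have := normr_ge0 t; nra.
Qed.

Lemma Re_le_nrm (R : realType) (l : R[i]) : `|complex.Re l| <= nrm l.
Proof. by rewrite -lecR nrmE normc_ge_Re. Qed.

Lemma Im_le_nrm (R : realType) (l : R[i]) : `|complex.Im l| <= nrm l.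
Proof.
case: l => s t /=; rewrite -sqrtr_sqr /nrm normc_def/= ler_wsqrtr//.
by rewrite lerDr sqr_ge0.
Qed.

Lemma nrm_real (R : realType) (t : R) : nrm (t%:C) = `|t|.
Proof. by rewrite /nrm normc_def/= expr0n addr0 sqrtr_sqr. Qed.

(** * Root-null sequences *)

Definition root_null (R : realType) (V : normedZmodType R[i]) (u : nat -> V) :=
  forall e : R, 0 < e -> \forall n \near \oo, nrm (u n) <= e ^+ n.

(** The exponent 1/0 = 0 gives the index 0 the value 1, whatever u is; only
positive indices are compared. *)
Lemma limn_esup_root_eq0 (R : realType) (V : normedZmodType R[i])
    (u : nat -> V) :
  limn_esup (fun n => (nrm (u n) `^ n%:R^-1)%:E) = 0%E <-> root_null u.
Proof.
have rootle n e : (0 < n)%N -> 0 < e ->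
    (nrm (u n) `^ n%:R^-1 <= e) = (nrm (u n) <= e ^+ n).
  move=> n0 e0; have nE : nrm (u n) = (nrm (u n) `^ n%:R^-1) ^+ n.
    rewrite -powR_mulrn ?powR_ge0// -powRrM mulVf ?powRr1 ?nrm_ge0//.
    by rewrite pnatr_eq0 -lt0n.
  by rewrite [X in _ = (X <= _)]nE ler_pXn2r// nnegrE ?powR_ge0 ?ltW.
rewrite /limn_esup limf_esupE; split => [u0 e e0|unull].
  have : (ereal_inf [set ereal_sup ((fun n => (nrm (u n) `^ n%:R^-1)%:E) @` V)
      | V in \oo] < e%:E)%E by rewrite u0 lte_fin.
  move=> /ereal_inf_lt[_ [P Poo <-]] supP.
  near=> n; rewrite -rootle//; last by near: n; exact: nbhs_infty_gt.
  rewrite -lee_fin; apply: le_trans (ltW supP); apply: ereal_sup_ubound.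
  by exists n => //; near: n.
apply/eqP; rewrite eq_le; apply/andP; split; last first.
  apply: limf_esup_ge0 => [|n]; last by rewrite lee_fin powR_ge0.
  exact: filter_not_empty.
apply/lee_addgt0Pr => e e0; rewrite add0e.
apply: (@le_trans _ _ (ereal_sup ((fun n => (nrm (u n) `^ n%:R^-1)%:E) @`
  [set n | (0 < n)%N /\ nrm (u n) <= e ^+ n]))).
  apply: ereal_inf_lbound.
  exists [set n | (0 < n)%N /\ nrm (u n) <= e ^+ n] => //.
  by apply: filterI; [exact: nbhs_infty_gt|exact: unull].
apply: ge_ereal_sup => _ [n [n0 une] <-].
by rewrite lee_fin rootle.
Unshelve. all: by end_near. Qed.

(** A bound valid at all indices, at the price of a constant, is what products
and binomial expansions need. *)
Lemma root_nullP (R : realType) (V : normedZmodType R[i]) (u : nat -> V) :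
  root_null u <->
  forall e : R, 0 < e -> exists C, forall n, nrm (u n) <= C * e ^+ n.
Proof.
split=> [unull e e0|ubnd e e0].
  have [N _ leN] := unull e e0.
  (* The sum absorbs the finitely many indices below N. *)
  exists (1 + \sum_(i < N) nrm (u i) / e ^+ i) => n.
  have en0 : 0 < e ^+ n by rewrite exprn_gt0.
  have sum0 : 0 <= \sum_(i < N) nrm (u i) / e ^+ i.
    by apply: sumr_ge0 => i _; rewrite divr_ge0 ?nrm_ge0 ?exprn_ge0 ?ltW.
  rewrite -ler_pdivrMr//; have [Nn|nN] := leqP N n.
    rewrite ler_wpDr// ler_pdivrMr// mul1r; exact: leN.
  rewrite ler_wpDl// (bigD1 (Ordinal nN))//= ler_wpDr//.
  by apply: sumr_ge0 => i _; rewrite divr_ge0 ?nrm_ge0 ?exprn_ge0 ?ltW.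
(* A rate of e / 2 leaves a factor 2^-n, which beats the constant. *)
have e20 : 0 < e / 2 by rewrite divr_gt0.
have [C leC] := ubnd _ e20.
have C0 : 0 < `|C| + 1 by rewrite ltr_wpDl.
have : (fun n => (1 / 2 : R) ^+ n) @ \oo --> 0.
  by apply: cvg_expr; rewrite ger0_norm; lra.
move/cvgrPdist_le => /(_ (`|C| + 1)^-1); rewrite invr_gt0 => /(_ C0).
apply: filterS => n; have h0 : 0 <= (1 / 2 : R) by lra.
rewrite sub0r normrN ger0_norm ?exprn_ge0// => half.
apply: le_trans (leC n) _.
have -> : (e / 2) ^+ n = (1 / 2) ^+ n * e ^+ n.
  by rewrite -exprMn; congr (_ ^+ n); ring.
rewrite mulrA -[leRHS]mul1r ler_wpM2r ?exprn_ge0 ?(ltW e0)//.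
apply: (@le_trans _ _ ((`|C| + 1) * (1 / 2) ^+ n)).
  by rewrite ler_wpM2r ?exprn_ge0// ler_wpDr// ler_norm.
by rewrite mulrC -ler_pdivlMr// [leRHS]mul1r.
Qed.

Section RootNullProducts.
Variables (R : realType) (A : banachAlg R[i]).
Implicit Types p q : A.

Lemma root_nullMl (u : nat -> A) p :
  root_null u -> root_null (fun n => p * u n).
Proof.
move=> /root_nullP ubnd; apply/root_nullP => e /ubnd[C leC].
exists (nrm p * C) => n; apply: le_trans (nrmM _ _) _.
by rewrite -mulrA ler_wpM2l ?nrm_ge0.
Qed.

Lemma root_nullMr (u : nat -> A) q :
  root_null u -> root_null (fun n => u n * q).
Proof.
move=> /root_nullP ubnd; apply/root_nullP => e /ubnd[C leC].
exists (nrm q * C) => n; apply: le_trans (nrmM _ _) _.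
by rewrite mulrC -mulrA ler_wpM2l ?nrm_ge0.
Qed.

End RootNullProducts.

Lemma dist_ab_eq0 (R : realType) (A : banachAlg R[i]) (a b : A) :
  dist_ab a b = 0%E <->
  root_null (fun n => iter n (commutator_op a b) 1) /\
  root_null (fun n => iter n (commutator_op b a) 1).
Proof.
have rho_ge0 (x y : A) : (0 <= rho x y)%E.
  apply: limf_esup_ge0 => [|n]; last by rewrite lee_fin powR_ge0.
  exact: filter_not_empty.
have rho0 (x y : A) : rho x y = 0%E <->
    root_null (fun n => iter n (commutator_op x y) 1).
  exact: limn_esup_root_eq0.
rewrite -!rho0 /dist_ab; split => [/eqP|[-> ->]]; last by rewrite maxxx.
rewrite eq_le ge_max => /andP[/andP[ab ba] _].
by split; apply/eqP; rewrite eq_le rho_ge0 andbT; [exact: ab|exact: ba].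
Qed.

(** * Invertible elements and roots of unity *)

Lemma invertibleM (A : nzRingType) (x y : A) :
  invertible x -> invertible y -> invertible (x * y).
Proof.
move=> [u [ux xu]] [v [vy yv]]; exists (v * u); split.
  by rewrite mulrA -(mulrA v) ux mulr1.
by rewrite mulrA -(mulrA x) yv mulr1.
Qed.

Lemma invertibleZ (K : fieldType) (A : algType K) (k : K) (x : A) :
  k != 0 -> invertible x -> invertible (k *: x).
Proof.
move=> k0 [y [yx xy]]; exists (k^-1 *: y); split.
  by rewrite -scalerAl -scalerAr scalerA mulVf// scale1r.
by rewrite -scalerAl -scalerAr scalerA mulfV// scale1r.
Qed.

Lemma neumann_invertible (R : realType) (A : banachAlg R[i]) (y : A) :
  nrm y < 1 -> invertible (1 - y).
Proof.
move=> y1; set q := nrm y; set c := nrm (1 : A).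
have c0 : 0 < c by exact: nrm1_gt0.
have q0 : 0 <= q by exact: nrm_ge0.
pose S := series (fun k => y ^+ k : A).
have cvgS : cvgn S.
  apply/cauchy_cvgP/cauchy_seriesP => e e0.
  have eE : (complex.Re e)%:C = e by exact: RRe_real (gtr0_real e0).
  have e'0 : 0 < complex.Re e / c.
    by rewrite divr_gt0// -ltcR eE.
  have : cvgn (series (geometric 1 q)).
    by apply: is_cvg_geometric_series; rewrite ger0_norm.
  move=> /cauchy_cvgP/cauchy_seriesP/(_ _ e'0).
  apply: filterS => -[m n]/=; rewrite ltr_pdivlMr// => le_e.
  rewrite -nrmE -eE ltcR; apply: le_lt_trans le_e.
  apply: le_trans (nrm_sum _ _) _.
  rewrite mulrC; apply: le_trans (ler_wpM2l (ltW c0) (ler_norm _)).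
  rewrite mulr_sumr; apply: ler_sum => k _.
  by rewrite /geometric/= mul1r; exact: nrmX_le.
have telS n : (1 - y) * S n = 1 - y ^+ n /\ S n * (1 - y) = 1 - y ^+ n.
  elim: n => [|n [IH1 IH2]].
    by rewrite /S /series/= big_geq// mulr0 mul0r expr0 subrr.
  have -> : S n.+1 = S n + y ^+ n by rewrite /S seriesSr.
  rewrite mulrDr IH1 (mulrDl (S n)) IH2.
  rewrite [in _ * y ^+ n]mulrBl [in y ^+ n * _]mulrBr mul1r mulr1.
  rewrite -exprS -exprSr.
  by split; rewrite addrA subrK.
(* Each of the two inverse identities for the limit is obtained by comparing
   with the telescoped partial sums, an explicit form of the continuity of
   the product. *)
have small (w : A) d :
    (forall n, nrm w <= d * nrm (limn S - S n) + c * q ^+ n) -> w = 0.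
  move=> wle; apply: nrm_eq0; apply/eqP; rewrite eq_le nrm_ge0 andbT.
  apply/ler_addgt0Pr => e e0; rewrite add0r.
  have d0 : 0 < `|d| + 1 by rewrite ltr_wpDl.
  have SP : \forall n \near \oo, nrm (limn S - S n) <= e / 2 / (`|d| + 1).
    have e2 : 0 < (e / 2 / (`|d| + 1))%:C by rewrite ltcR !divr_gt0.
    move/cvgrPdist_le : cvgS => /(_ _ e2); apply: filterS => n.
    by rewrite -nrmE lecR.
  have qP : \forall n \near \oo, q ^+ n <= e / 2 / c.
    have e2 : 0 < e / 2 / c by rewrite !divr_gt0.
    have /cvgrPdist_le : (fun n => q ^+ n) @ \oo --> 0.
      by apply: cvg_expr; rewrite ger0_norm.
    move=> /(_ _ e2); apply: filterS => n.
    by rewrite sub0r normrN ger0_norm ?exprn_ge0.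
  near \oo => n.
  apply: le_trans (wle n) _; rewrite [leRHS]splitr; apply: lerD.
    apply: (@le_trans _ _ ((`|d| + 1) * nrm (limn S - S n))).
      by rewrite ler_wpM2r ?nrm_ge0// ler_wpDr// ler_norm.
    by rewrite mulrC -ler_pdivlMr//; near: n.
  by rewrite mulrC -ler_pdivlMr//; near: n.
exists (limn S); split; apply/eqP; rewrite -subr_eq0; apply/eqP;
  apply: (small _ (nrm (1 - y))) => n; have [tel1 tel2] := telS n.
- have -> : limn S * (1 - y) - 1 = (limn S - S n) * (1 - y) - y ^+ n.
    by rewrite mulrBl tel2 opprB addrA addrAC addrK addrC.
  apply: le_trans (nrmB _ _) _; apply: lerD (nrmX_le _ _).
  by rewrite mulrC; exact: nrmM.
- have -> : (1 - y) * limn S - 1 = (1 - y) * (limn S - S n) - y ^+ n.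
    by rewrite mulrBr tel1 opprB addrA addrAC addrK addrC.
  by apply: le_trans (nrmB _ _) _; apply: lerD (nrmX_le _ _); exact: nrmM.
Unshelve. all: by end_near. Qed.

Lemma closed_prim_root_exists (F : numClosedFieldType) n : (0 < n)%N ->
  exists z : F, n.-primitive_root z.
Proof.
move=> n0; have [rs] := closed_field_poly_normal ('X^n - 1 : {poly F}).
rewrite (monicP (monicXnsubC _ n0)) scale1r => rsE.
have /hasP[z _ zn] : has n.-primitive_root rs; last by exists z.
apply: has_prim_root => //.
- by apply/allP => z; rewrite -root_prod_XsubC -rsE.
- by rewrite -separable_prod_XsubC -rsE separable_Xn_sub_1// pnatr_eq0 -lt0n.
- by rewrite -ltnS -(size_prod_XsubC rs id) -rsE size_XnsubC.
Qed.

(** Multiplying by z^j - 1, which is nonzero, telescopes this geometric sum to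
z^(j n) - 1 = 0. *)
Lemma prim_root_sum_expr (F : fieldType) (z : F) n (j : nat) :
  n.-primitive_root z -> (0 < j < n)%N -> \sum_(k < n) z ^+ k ^+ j = 0.
Proof.
move=> zn /andP[j0 jn].
have zj1 : z ^+ j - 1 != 0.
  rewrite subr_eq0 -(expr0 z) (eq_prim_root_expr zn) mod0n modn_small//.
  by rewrite -lt0n.
apply: (mulfI zj1); rewrite mulr0.
under eq_bigr => k _ do rewrite exprAC.
by rewrite -subrX1 exprAC (prim_expr_order zn) expr1n subrr.
Qed.

(** * The resolvent and its averages over roots of unity *)

Section Resolvent.
Variables (R : realType) (A : banachAlg R[i]) (x : A).
Hypothesis inv : forall l : R[i], invertible (1 - l *: x).
Implicit Types (l m : R[i]) (s t r : R).

(** For nonzero l this is l^-1 (l^-1 - x)^-1, the usual resolvent of x up to the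
factor l^-1; in the variable l it extends to 0. *)
Definition resolvent l : A := sval (cid (inv l)).

Lemma resolvent_left l : resolvent l * (1 - l *: x) = 1.
Proof. by rewrite /resolvent; case: cid => y []. Qed.

Lemma resolvent_right l : (1 - l *: x) * resolvent l = 1.
Proof. by rewrite /resolvent; case: cid => y []. Qed.

Lemma resolvent_identity l m :
  resolvent l - resolvent m = (l - m) *: (resolvent l * x * resolvent m).
Proof.
have -> : (l - m) *: (resolvent l * x * resolvent m) =
    resolvent l * ((1 - m *: x) - (1 - l *: x)) * resolvent m.
  rewrite opprB [1 - _ + _]addrC addrA subrK -scalerBl.
  by rewrite -scalerAr -!scalerAl.
by rewrite mulrBr mulrBl resolvent_left mul1r -mulrA resolvent_right mulr1.
Qed.

Lemma resolvent_lipschitz l m :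
  nrm (resolvent l - resolvent m) <=
  nrm (l - m) * (nrm (resolvent l) * nrm x * nrm (resolvent m)).
Proof.
rewrite resolvent_identity nrmZ ler_wpM2l ?nrm_ge0//.
apply: le_trans (nrmM _ _) _; rewrite ler_wpM2r ?nrm_ge0//; exact: nrmM.
Qed.

(** Near each m the norm of the resolvent is at most twice its value at m, by
[resolvent_lipschitz]; compactness of the square of side 2 r around the disc
does the rest. *)
Lemma resolvent_bounded r : 0 <= r ->
  exists2 M, 0 < M & forall l, nrm l <= r -> nrm (resolvent l) <= M.
Proof.
move=> r0; pose K := `[- r, r]%classic : set R.
have cK : compact (K `*` K) by apply: compact_setX; exact: segment_compact.
have [M [_ KM]] : \forall M \near +oo, forall p, (K `*` K) p ->
    nrm (resolvent (p.1 +i* p.2)) <= M.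
  apply: (compact_near_coveringP _).1 => // -[s t] _.
  set l := s +i* t; set M := nrm (resolvent l).
  set d := (4 * (nrm x * M + 1))^-1.
  have M0 : 0 <= M by exact: nrm_ge0.
  have x0 : 0 <= nrm x by exact: nrm_ge0.
  have c0 : 0 <= nrm x * M by exact: mulr_ge0.
  have d0 : 0 < d by rewrite invr_gt0; lra.
  exists (ball (s, t) d, [set i | 2 * M <= i]).
    by split; [exact: nbhsx_ballx|apply: nbhs_pinfty_ge; exact: num_real].
  move=> [[s' t'] i]/= [[]]; rewrite /ball/= => ss' tt' Mi.
  apply: le_trans Mi; set l' := s' +i* t'.
  have ll' : nrm (l' - l) <= d * 2.
    have -> : l' - l = (s' - s) +i* (t' - t) by [].
    apply: le_trans (nrm_Complex_le _ _) _.
    rewrite mulr_natr mulr2n (distrC s') (distrC t'); exact/lerD/ltW/tt'/ltW.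
  have le1 : nrm (l' - l) * (nrm (resolvent l') * nrm x * M) <=
      nrm (resolvent l') / 2.
    have dE : d * 2 * (nrm x * M) <= 1 / 2.
      have -> : d * 2 = (2 * (nrm x * M + 1))^-1.
        by rewrite /d; field; rewrite gt_eqF//; lra.
      by rewrite mulrC ler_pdivrMr; lra.
    have b0 := nrm_ge0 (resolvent l').
    apply: (@le_trans _ _ (d * 2 * (nrm (resolvent l') * nrm x * M))).
      by rewrite ler_wpM2r// !mulr_ge0.
    have -> : d * 2 * (nrm (resolvent l') * nrm x * M) =
        nrm (resolvent l') * (d * 2 * (nrm x * M)) by ring.
    by rewrite ler_wpM2l// -[leRHS]mul1r.
  have := resolvent_lipschitz l' l; rewrite -/M => le2.
  have : nrm (resolvent l') <= nrm (resolvent l' - resolvent l) + M.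
    by rewrite -[in leLHS](subrK (resolvent l) (resolvent l')) nrmD.
  lra.
exists (`|M| + 1) => [|l lr]; first by rewrite ltr_wpDl.
have := KM (`|M| + 1); have Mlt : M < `|M| + 1.
  by rewrite ltr_pwDr// ler_norm.
move=> /(_ Mlt (complex.Re l, complex.Im l)) /=.
have -> : complex.Re l +i* complex.Im l = l by case: l {lr}.
apply; split; rewrite /K/= in_itv/= -ler_norml.
- exact: le_trans (Re_le_nrm _) lr.
- exact: le_trans (Im_le_nrm _) lr.
Qed.

Definition resolvent_avg n (w l : R[i]) : A :=
  n%:R^-1 *: \sum_(k < n) resolvent (w ^+ k * l).

(** The factor 1 - y^n is divisible by 1 - y for y = w^k l x, and y^n = (l x)^n
does not depend on k. So the k-th term becomes the sum of the powers y^j for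
j < n, and averaging over k kills all of them but j = 0. *)
Lemma resolvent_avgP n (w l : R[i]) : (0 < n)%N -> n.-primitive_root w ->
  resolvent_avg n w l * (1 - (l *: x) ^+ n) = 1.
Proof.
move=> n0 wn; rewrite /resolvent_avg -scalerAl mulr_suml.
have -> : \sum_(k < n) resolvent (w ^+ k * l) * (1 - (l *: x) ^+ n) =
    \sum_(k < n) \sum_(j < n) (w ^+ k ^+ j) *: (l *: x) ^+ j.
  apply: eq_bigr => k _; pose y := (w ^+ k * l) *: x.
  have yE j : y ^+ j = (w ^+ k ^+ j) *: (l *: x) ^+ j.
    by rewrite /y -scalerA exprZn.
  have -> : (l *: x) ^+ n = y ^+ n.
    by rewrite yE exprAC (prim_expr_order wn) expr1n scale1r.
  rewrite -opprB subrX1 -mulNr opprB mulrA resolvent_left mul1r.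
  by apply: eq_bigr => j _; exact: yE.
rewrite exchange_big/= (bigD1 (Ordinal n0))//=.
rewrite [X in _ + X]big1 ?addr0 => [|j j0].
  rewrite (eq_bigr (fun=> 1)) => [|k _]; last by rewrite !expr0 scale1r.
  rewrite sumr_const card_ord -(scaler_nat n (1 : A)) scalerA mulVf ?scale1r//.
  by rewrite pnatr_eq0 -lt0n.
rewrite -scaler_suml (prim_root_sum_expr wn) ?scale0r// ltn_ord andbT lt0n.
by apply: contra j0 => /eqP j0; apply/eqP/val_inj.
Qed.

Lemma nrm_prim_root n (w : R[i]) : (0 < n)%N -> n.-primitive_root w ->
  nrm w = 1.
Proof.
move=> n0 wn; apply: complexI; rewrite nrmE; apply/eqP.
by rewrite -(@pexpr_eq1 _ _ n)// -normrX (prim_expr_order wn) normr1.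
Qed.

Lemma nrm_prim_rootX n (w : R[i]) k : (0 < n)%N -> n.-primitive_root w ->
  nrm (w ^+ k) = 1.
Proof.
move=> n0 wn; apply: complexI.
by rewrite nrmE normrX -nrmE (nrm_prim_root n0 wn) expr1n.
Qed.

Lemma resolvent_avg_bounded n (w l : R[i]) M r : (0 < n)%N ->
  n.-primitive_root w ->
  (forall m, nrm m <= r -> nrm (resolvent m) <= M) -> nrm l <= r ->
  nrm (resolvent_avg n w l) <= M.
Proof.
move=> n0 wn resM lr; rewrite /resolvent_avg nrmZ.
have -> : nrm (n%:R^-1 : R[i]) = n%:R^-1.
  by rewrite -(rmorph_nat (real_complex R)) -fmorphV nrm_real ger0_norm.
rewrite ler_pdivrMl ?ltr0n//; apply: le_trans (nrm_sum _ _) _.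
rewrite mulr_natl -[X in _ *+ X](card_ord n) -sumr_const; apply: ler_sum => k _.
by apply: resM; rewrite nrmCM (nrm_prim_rootX _ n0 wn) mul1r.
Qed.

Lemma resolvent_avg_lipschitz n (w l m : R[i]) M r : (0 < n)%N ->
  n.-primitive_root w ->
  (forall m, nrm m <= r -> nrm (resolvent m) <= M) ->
  nrm l <= r -> nrm m <= r ->
  nrm (resolvent_avg n w l - resolvent_avg n w m) <=
  nrm (l - m) * (M * nrm x * M).
Proof.
move=> n0 wn resM lr mr; rewrite /resolvent_avg -scalerBr -sumrB nrmZ.
have -> : nrm (n%:R^-1 : R[i]) = n%:R^-1.
  by rewrite -(rmorph_nat (real_complex R)) -fmorphV nrm_real ger0_norm.
rewrite ler_pdivrMl ?ltr0n//; apply: le_trans (nrm_sum _ _) _.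
rewrite mulr_natl -[X in _ *+ X](card_ord n) -sumr_const; apply: ler_sum => k _.
apply: le_trans (resolvent_lipschitz _ _) _.
rewrite -mulrBr nrmCM (nrm_prim_rootX _ n0 wn) mul1r ler_wpM2l ?nrm_ge0//.
have resMw (p : R[i]) : nrm p <= r -> nrm (resolvent (w ^+ k * p)) <= M.
  by move=> pr; apply: resM; rewrite nrmCM (nrm_prim_rootX _ n0 wn) mul1r.
by rewrite ler_pM ?mulr_ge0 ?nrm_ge0 ?resMw// ler_wpM2r ?nrm_ge0 ?resMw.
Qed.

End Resolvent.

(** * Quasinilpotent elements *)

Section Decay.
Variables (R : realType) (A : banachAlg R[i]) (x : A).
Hypothesis inv : forall l : R[i], invertible (1 - l *: x).
Implicit Types (s t r : R).

Definition powers_vanish t :=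
  forall e : R, 0 < e -> \forall n \near \oo, t ^+ n * nrm (x ^+ n) <= e.

Lemma nrm_scale_exp t n : 0 <= t ->
  nrm ((t%:C *: x) ^+ n) = t ^+ n * nrm (x ^+ n).
Proof.
by move=> t0; rewrite exprZn nrmZ -rmorphXn/= nrm_real ger0_norm ?exprn_ge0.
Qed.

(** If (s x)^n -> 0 then the average U at s, inverse to 1 - (s x)^n, tends to 1.
The Lipschitz bound, uniform in n, keeps the average V at t within 1/2 of 1, and
V (1 - (t x)^n) = 1 then bounds (t x)^n by 1. *)
Lemma powers_vanish_step M r s t :
  0 < M -> (forall l, nrm l <= r -> nrm (resolvent inv l) <= M) ->
  0 <= s -> s <= t -> t <= r -> (t - s) * (M * nrm x * M) <= 1 / 4 ->
  powers_vanish s -> \forall n \near \oo, t ^+ n * nrm (x ^+ n) <= 1.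
Proof.
move=> M0 resM s0 st tr small sx.
have t0 : 0 <= t by exact: le_trans st.
have M4 : 0 < (4 * M)^-1 by rewrite invr_gt0 mulr_gt0.
have nrmC u : 0 <= u -> nrm (u%:C : R[i]) = u.
  by move=> u0; rewrite nrm_real ger0_norm.
near=> n.
have n0 : (0 < n)%N by near: n; exact: nbhs_infty_gt.
have [w wn] := @closed_prim_root_exists R[i] n n0.
set y := (s%:C *: x) ^+ n; set z := (t%:C *: x) ^+ n.
set U := resolvent_avg inv n w s%:C; set V := resolvent_avg inv n w t%:C.
have Uy : U * (1 - y) = 1 by exact: resolvent_avgP.
have Vz : V * (1 - z) = 1 by exact: resolvent_avgP.
have yle : nrm y <= (4 * M)^-1.
  by rewrite nrm_scale_exp//; near: n; exact: sx.
have Ule : nrm (U - 1) <= 1 / 4.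
  have -> : U - 1 = U * y by rewrite -Uy mulrBr mulr1 opprB addrC subrK.
  apply: le_trans (nrmM _ _) _; apply: (@le_trans _ _ (M * (4 * M)^-1)).
    rewrite ler_pM ?nrm_ge0//; apply: (resolvent_avg_bounded (r := r)) => //.
    by rewrite nrmC// (le_trans st).
  by rewrite (_ : M * _ = 1 / 4)//; field; rewrite gt_eqF.
have VU : nrm (V - U) <= 1 / 4.
  apply: le_trans small.
  rewrite -[X in X * _](nrmC (t - s)) ?subr_ge0// rmorphB/=.
  apply: (resolvent_avg_lipschitz (r := r)) => //; rewrite nrmC//.
  exact: le_trans tr.
have Vle : nrm (V - 1) <= 1 / 2.
  have := nrmD (V - U) (U - 1); rewrite addrA subrK; lra.
have zE : z = (V - 1) - (V - 1) * z.
  have Vz' : V * z = V - 1 by rewrite -Vz mulrBr mulr1 opprB addrC subrK.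
  by rewrite mulrBl mul1r Vz' opprB addrC subrK.
rewrite -nrm_scale_exp// -/z.
have : nrm z <= nrm (V - 1) + nrm (V - 1) * nrm z.
  by rewrite {1}zE; apply: le_trans (nrmB _ _) _; rewrite lerD2l nrmM.
have := nrm_ge0 z; have := nrm_ge0 (V - 1); nra.
Unshelve. all: by end_near. Qed.

Lemma powers_vanish_lt s t : 0 <= s -> s < t ->
  (\forall n \near \oo, t ^+ n * nrm (x ^+ n) <= 1) -> powers_vanish s.
Proof.
move=> s0 st bnd e e0.
have t0 : 0 < t by exact: le_lt_trans st.
have q0 : 0 <= s / t by rewrite divr_ge0// ltW.
have q1 : s / t < 1 by rewrite ltr_pdivrMr// mul1r.
have /cvgrPdist_le : (fun n => (s / t) ^+ n) @ \oo --> 0.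
  by apply: cvg_expr; rewrite ger0_norm.
move=> /(_ _ e0) small.
near=> n.
have qe : (s / t) ^+ n <= e.
  have : `|0 - (s / t) ^+ n| <= e by near: n.
  by rewrite sub0r normrN ger0_norm// exprn_ge0.
have tn1 : t ^+ n * nrm (x ^+ n) <= 1 by near: n.
have -> : s ^+ n = (s / t) ^+ n * t ^+ n.
  by rewrite -exprMn divfK// gt_eqF.
rewrite -mulrA; apply: le_trans qe.
by rewrite -[leRHS]mulr1 ler_wpM2l ?exprn_ge0.
Unshelve. all: by end_near. Qed.

(** The step is iterated along the multiples of a fixed h up to r. Each step
reaches 2 h further to obtain a bound, and gives up h to turn this bound into
convergence to 0. *)
Lemma powers_vanish_all r : 0 <= r -> powers_vanish r.
Proof.
move=> r0; have r1 : 0 <= r + 1 by rewrite addr_ge0.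
have [M M0 resM] := resolvent_bounded inv r1.
set K := M * nrm x * M.
have K0 : 0 <= K by rewrite !mulr_ge0 ?nrm_ge0// ltW.
(* This makes 2 h K <= 1/4, as the step requires, and 2 h <= 1, which keeps
   the reach of the last step inside the disc of radius r + 1. *)
pose h := (8 * (K + 1))^-1.
have h0 : 0 < h by rewrite invr_gt0; lra.
have hE : h * (8 * (K + 1)) = 1 by rewrite mulVf// gt_eqF//; lra.
have hK0 : 0 <= h * K by rewrite mulr_ge0// ltW.
have hK : (2 * h) * K <= 1 / 4 by lra.
have step (k : nat) : k%:R * h <= r -> powers_vanish (k%:R * h) ->
    \forall n \near \oo, (k%:R * h + 2 * h) ^+ n * nrm (x ^+ n) <= 1.
  move=> khr; apply: (powers_vanish_step M0 resM); rewrite -/K.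
  - by rewrite mulr_ge0// ltW.
  - by rewrite lerDl; lra.
  - by rewrite lerD//; lra.
  - by rewrite addrAC subrr add0r.
have grid (k : nat) : k%:R * h <= r -> powers_vanish (k%:R * h).
  elim: k => [_|k IH kr].
    move=> e e0; near=> n; rewrite mul0r expr0n gtn_eqF ?mul0r ?ltW//.
    by near: n; exact: nbhs_infty_gt.
  rewrite -natr1 mulrDl mul1r in kr *.
  have kr' : k%:R * h <= r by lra.
  apply: powers_vanish_lt (step k kr' (IH kr')); last by lra.
  by rewrite addr_ge0 ?mulr_ge0// ltW.
have rh0 : 0 <= r / h by rewrite divr_ge0// ltW.
have /andP[kr rk] := truncn_itv rh0.
rewrite ler_pdivlMr// in kr; rewrite ltr_pdivrMr// -natr1 mulrDl mul1r in rk.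
apply: powers_vanish_lt (step _ kr (grid _ kr)) => //.
by lra.
Unshelve. all: by end_near. Qed.

End Decay.

(** For nonzero l, 1 - l x = l (l^-1 - x) is invertible; hence (t x)^n -> 0 for
all t, in particular for t = 1 / e. *)
Lemma spectrum_sub0_root_null (R : realType) (A : banachAlg R[i]) (x : A) :
  spectrum x `<=` [set 0] -> root_null (fun n => x ^+ n).
Proof.
move=> spx e e0.
have inv (l : R[i]) : invertible (1 - l *: x).
  have [->|l0] := eqVneq l 0.
    by rewrite scale0r subr0; exists 1; rewrite mul1r.
  have inv_l : invertible (l^-1%:A - x).
    apply: contrapT => /spx/= /eqP; rewrite invr_eq0; exact/negP.
  have -> : 1 - l *: x = l *: (l^-1%:A - x).
    by rewrite scalerBr scalerA mulfV// scale1r.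
  exact: invertibleZ.
have ei : 0 <= e^-1 by rewrite invr_ge0 ltW.
apply: filterS (powers_vanish_all inv ei ltr01) => n.
by rewrite exprVn mulrC ler_pdivrMr ?exprn_gt0// mul1r.
Qed.

(** For z nonzero, some power y^n of y = x / z has norm less than 1, so 1 - y^n
is invertible; its factor 1 - y divides it on both sides, hence is invertible
too. *)
Lemma root_null_spectrum_sub0 (R : realType) (A : banachAlg R[i]) (x : A) :
  root_null (fun n => x ^+ n) -> spectrum x `<=` [set 0].
Proof.
move=> xnull z; apply: contra_notP => /eqP z0.
pose y := z^-1 *: x.
have nz : 0 < nrm z by rewrite lt_neqAle nrm_ge0 andbT eq_sym;
  apply: contra z0 => /eqP/nrm_eq0 ->.
have e0 : 0 < nrm z / 2 by rewrite divr_gt0.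
have [n [n0 yn]] : exists n, (0 < n)%N /\ nrm (y ^+ n) < 1.
  near \oo => n; exists n; split; first by near: n; exact: nbhs_infty_gt.
  have n0 : (0 < n)%N by near: n; exact: nbhs_infty_gt.
  have xn : nrm (x ^+ n) <= (nrm z / 2) ^+ n by near: n; exact: xnull.
  have zn0 : 0 < nrm (z ^+ n).
    by rewrite -ltcR nrmE normr_gt0 expf_neq0.
  rewrite -(ltr_pM2l zn0) mulr1 -nrmZ /y exprZn exprVn scalerA.
  rewrite mulfV ?expf_neq0// scale1r; apply: le_lt_trans xn _.
  have -> : nrm (z ^+ n) = nrm z ^+ n.
    by apply: complexI; rewrite nrmE normrX rmorphXn/= nrmE.
  by rewrite ltr_pXn2r ?nnegrE ?ltW//; lra.
have [u [ul ur]] := neumann_invertible yn.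
have -> : z%:A - x = z *: (1 - y).
  by rewrite scalerBr /y scalerA mulfV// scale1r.
pose g := \sum_(i < n) y ^+ i.
have yg : (1 - y) * g = 1 - y ^+ n.
  by rewrite -opprB mulNr -subrX1 opprB.
have gy : g * (1 - y) = 1 - y ^+ n.
  rewrite -yg mulrBr mulrBl mulr1 mul1r; congr (_ - _).
  rewrite /g mulr_suml mulr_sumr; apply: eq_bigr => i _.
  by rewrite -exprS exprSr.
have ly : u * g * (1 - y) = 1 by rewrite -mulrA gy.
have ry : (1 - y) * (g * u) = 1 by rewrite mulrA yg.
have E : u * g = g * u by rewrite -[LHS]mulr1 -ry mulrA ly mul1r.
by apply: invertibleZ => //; exists (g * u); rewrite -{1}E.
Unshelve. all: by end_near. Qed.

(** Otherwise 1 = y^n x^n, with y the inverse of x, would have norm tending to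
0. *)
Lemma invertible_not_root_null (R : realType) (A : banachAlg R[i]) (x : A) :
  invertible x -> ~ root_null (fun n => x ^+ n).
Proof.
move=> [y [yx _]] xnull.
have yxn n : y ^+ n * x ^+ n = 1.
  elim: n => [|n IH]; first by rewrite mulr1.
  by rewrite exprSr exprS mulrA -(mulrA (y ^+ n)) yx mulr1.
clear yx; have y0 := nrm_ge0 y.
have e0 : 0 < (2 * (nrm y + 1))^-1 by rewrite invr_gt0; lra.
have h1 : (1 : R) / 2 < 1 by lra.
have h2 : 0 <= (1 : R) / 2 by lra.
have /cvgrPdist_lt/(_ _ ltr01) half :
    (fun n => (1 / 2 : R) ^+ n) @ \oo --> 0.
  by apply: cvg_expr; rewrite ger0_norm//; lra.
near \oo => n.
have xn : nrm (x ^+ n) <= (2 * (nrm y + 1))^-1 ^+ n by near: n; exact: xnull.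
have hn : `|0 - (1 / 2 : R) ^+ n| < 1 by near: n.
rewrite sub0r normrN ger0_norm ?(exprn_ge0 n h2)// in hn.
have c0 := @nrm1_gt0 R A.
have : nrm (1 : A) <= nrm (1 : A) * (1 / 2) ^+ n.
  rewrite -{1}(yxn n); apply: le_trans (nrmM _ _) _.
  apply: (@le_trans _ _ (nrm (1 : A) * nrm y ^+ n * (2 * (nrm y + 1))^-1 ^+ n)).
    by rewrite ler_pM ?nrm_ge0// nrmX_le.
  rewrite -mulrA ler_wpM2l ?nrm_ge0// -exprMn lerXn2r ?nnegrE//.
    by rewrite mulr_ge0// ltW.
  by rewrite ler_pdivrMr; lra.
by apply/negP; rewrite -ltNge gtr_pMr.
Unshelve. all: by end_near. Qed.

(** This is the spectral radius formula at radius 0; it includes that 0 does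
belong to the spectrum. *)
Lemma quasinilpotentP (R : realType) (A : banachAlg R[i]) (x : A) :
  quasinilpotent x <-> root_null (fun n => x ^+ n).
Proof.
split=> [spx|xnull]; first by apply: spectrum_sub0_root_null; rewrite spx.
apply/seteqP; split; first exact: root_null_spectrum_sub0.
move=> _ -> xinv; apply: (invertible_not_root_null _ xnull).
have [y [yl yr]] := xinv; exists (- y).
by move: yl yr; rewrite scale0r sub0r !mulrN !mulNr => -> ->.
Qed.

(** * Polynomials in an element and the spectrum *)

Lemma comm_horner_alg (K : comNzRingType) (A : algType K) (y a : A)
  (p : {poly K}) : GRing.comm y a -> GRing.comm y (horner_alg a p).
Proof.
move=> ya; elim/poly_ind: p => [|p c IH].
  by rewrite rmorph0; exact: commr0.
rewrite rmorphD rmorphM/= horner_algX horner_algC; apply: commrD.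
  exact: commrM.
by rewrite /GRing.comm mulr_algl mulr_algr.
Qed.

Lemma invertible_horner_alg (K : closedFieldType) (A : algType K) (a : A)
    (Q : {poly K}) : Q != 0 ->
  (forall r, root Q r -> invertible (a - r%:A)) -> invertible (horner_alg a Q).
Proof.
move=> Q0 inv; have [rs QE] := closed_field_poly_normal Q.
have rsQ r : r \in rs -> root Q r.
  by rewrite QE rootZ ?lead_coef_eq0// root_prod_XsubC.
rewrite QE linearZ/= mulr_algl.
apply: invertibleZ; first by rewrite lead_coef_eq0.
rewrite rmorph_prod/=; elim: rs {QE} rsQ => [|r rs IH] rsQ.
  by rewrite big_nil; exists 1; rewrite mulr1.
rewrite big_cons; apply: invertibleM.
  rewrite rmorphB/= horner_algX horner_algC; apply: inv; apply: rsQ.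
  by rewrite mem_head.
by apply: IH => t trs; apply: rsQ; rewrite in_cons trs orbT.
Qed.

(** The easy half of the spectral mapping theorem: if P takes
the value z nowhere on the spectrum, then z - P(a) factors into invertible
elements a - r. *)
Lemma spectrum_horner_alg (K : numClosedFieldType) (A : algType K) (a : A)
    (P : {poly K}) (z : K) : (1 < size P)%N ->
  spectrum (horner_alg a P) z -> exists2 l, spectrum a l & P.[l] = z.
Proof.
move=> P1 Pz; apply: contrapT => nex; apply: Pz.
have -> : z%:A - horner_alg a P = horner_alg a (z%:P - P).
  by rewrite rmorphB/= horner_algC.
apply: invertible_horner_alg => [|r].
  rewrite subr_eq0; apply: contraTneq P1 => <-.
  by rewrite size_polyC -leqNgt leq_b1.
rewrite /root !hornerE subr_eq0 => /eqP zE.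
have [y [yl yr]] : invertible (r%:A - a).
  by apply: contrapT => spr; apply: nex; exists r.
by exists (- y); rewrite mulNr mulrN -mulrN -mulNr opprB.
Qed.

Section Lagrange.
Variables (K : fieldType) (s : seq K).
Hypothesis s_uniq : uniq s.

Definition lagrange_basis (l : K) : {poly K} :=
  (\prod_(m <- s | m != l) (l - m))^-1 *: \prod_(m <- s | m != l) ('X - m%:P).

Lemma lagrange_basis_eval l k : l \in s -> k \in s ->
  (lagrange_basis l).[k] = (l == k)%:R.
Proof.
move=> ls ks; rewrite /lagrange_basis hornerZ horner_prod.
rewrite [X in _ * X](eq_bigr (fun m => k - m)) => [|m _]; last first.
  by rewrite hornerXsubC.
have [<-|lk] := eqVneq l k.
  rewrite mulVf// prodf_seq_neq0; apply/allP => m _.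
  by apply/implyP; rewrite subr_eq0 eq_sym.
by rewrite [X in _ * X](big_rem k)//= eq_sym lk subrr mul0r mulr0.
Qed.

Lemma size_lagrange_basis l : l \in s -> (size (lagrange_basis l) <= size s)%N.
Proof.
move=> ls; apply: leq_trans (size_scale_leq _ _) _.
rewrite -big_filter size_prod_XsubC -rem_filter// size_rem// prednK//.
by case: (s) ls.
Qed.

Lemma sum_lagrange_basis : s != [::] -> \sum_(l <- s) lagrange_basis l = 1.
Proof.
move=> s0; apply/eqP; rewrite -subr_eq0; apply/eqP.
apply: (@roots_geq_poly_eq0 _ _ s) => //.
  apply/allP => k ks; rewrite /root !hornerE horner_sum (bigD1_seq k)//=.
  rewrite lagrange_basis_eval// eqxx big_seq_cond big1 ?addr0 ?subrr//.
  by move=> l /andP[ls lk]; rewrite lagrange_basis_eval// (negPf lk).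
apply: leq_trans (size_polyD _ _) _; rewrite geq_max size_polyN size_poly1.
apply/andP; split; last by case: (s) s0.
apply: leq_trans (size_sum _ _ _) _.
by apply/bigmax_leqP_seq => l ls _; exact: size_lagrange_basis.
Qed.

Lemma lagrange_basis_mulX l : l \in s -> exists c : K,
  ('X - l%:P) * lagrange_basis l = c%:P * \prod_(m <- s) ('X - m%:P).
Proof.
move=> ls; exists (\prod_(m <- s | m != l) (l - m))^-1.
by rewrite mul_polyC -scalerAr [in RHS](bigD1_seq l).
Qed.

End Lagrange.

(** The p l, Lagrange polynomials evaluated at a, are the spectral projections
of a. *)
Lemma annulled_spectral_resolution (K : fieldType) (A : algType K) (a : A)
    (s : seq K) : uniq s -> s != [::] ->
    horner_alg a (\prod_(l <- s) ('X - l%:P)) = 0 ->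
  exists p : K -> A, \sum_(l <- s) p l = 1 /\
    forall l, l \in s -> a * p l = l *: p l /\ p l * a = l *: p l.
Proof.
move=> us s0 aP; exists (fun l => horner_alg a (lagrange_basis s l)); split.
  by rewrite -rmorph_sum sum_lagrange_basis// rmorph1.
move=> l ls.
have aL : a * horner_alg a (lagrange_basis s l) =
    l *: horner_alg a (lagrange_basis s l).
  apply/eqP; rewrite -subr_eq0 -mulr_algl -mulrBl.
  have [c Lc] := lagrange_basis_mulX us ls.
  have := congr1 (horner_alg a) Lc.
  by rewrite !rmorphM rmorphB/= horner_algX horner_algC aP mulr0 => ->.
by split => //; rewrite -aL; apply/esym; exact: comm_horner_alg.
Qed.

(** * Normal elements with finite spectrum *)

Section CStar.
Variables (R : realType) (A : cstarAlg R[i]).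
Implicit Types (x w a : A).

Lemma nrm_starM x : nrm (star x * x) = nrm x ^+ 2.
Proof.
by apply: complexI; rewrite nrmE norm_starM -nrmE rmorphXn.
Qed.

Lemma normal_sqr w : normal_elt w -> normal_elt (w * w).
Proof.
by move=> wn; rewrite /normal_elt starM; apply: commrM; apply: commr_sym;
  apply: commrM; apply: commr_sym.
Qed.

(** Both squares equal the norm of h^2, where h = w^* w is self-adjoint: on the
left because w and w^* commute, on the right by the C*-identity, used for h and
for w. *)
Lemma nrm_normal_sqr w : normal_elt w -> nrm (w * w) = nrm w ^+ 2.
Proof.
move=> wn; apply/eqP; rewrite -(@eqrXn2 _ 2)// ?exprn_ge0 ?nrm_ge0//.
have hE : star (star w * w) = star w * w by rewrite starM starK.
have hh : star w * star w * (w * w) = (star w * w) * (star w * w).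
  by rewrite mulrA -(mulrA (star w) (star w) w) -{1}wn !mulrA.
by rewrite -(nrm_starM (w * w)) starM hh -(nrm_starM w) -nrm_starM hE.
Qed.

Lemma nrm_normal_exp2 w k : normal_elt w ->
  nrm (w ^+ (2 ^ k)) = nrm w ^+ (2 ^ k).
Proof.
move=> wn; have: nrm (w ^+ (2 ^ k)) = nrm w ^+ (2 ^ k) /\
    normal_elt (w ^+ (2 ^ k)).
  elim: k => [|k [IH1 IH2]]; first by rewrite expn0 !expr1.
  rewrite expnS mulnC 2!exprM expr2 -IH1 nrm_normal_sqr//; split => //.
  exact: normal_sqr.
by case.
Qed.

(** A normal element attains its spectral radius: along the exponents 2^k, the
n-th roots of the norms are constant. *)
Lemma normal_root_null_eq0 w : normal_elt w ->
  root_null (fun n => w ^+ n) -> w = 0.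
Proof.
move=> wn wnull; apply/nrm_eq0/eqP; rewrite eq_le nrm_ge0 andbT leNgt.
apply/negP => w0; have w20 : 0 < nrm w / 2 by rewrite divr_gt0.
have [N _ leN] := wnull _ w20.
have := leN (2 ^ N)%N (ltnW (ltn_expl N (ltnSn 1))).
rewrite /= nrm_normal_exp2//; apply/negP; rewrite -ltNge.
by rewrite ltr_pXn2r ?nnegrE ?ltW ?expn_gt0//; lra.
Qed.
End CStar.

(** The polynomial vanishes on the spectrum, so its value w at a has spectrum
contained in 0, and w is normal. *)
Lemma normal_finite_spectrum_annul (R : realType) (A : cstarAlg R[i]) (a : A) :
  normal_elt a -> finite_set (spectrum a) ->
  exists s : seq R[i], [/\ uniq s, s != [::] &
    horner_alg a (\prod_(l <- s) ('X - l%:P)) = 0].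
Proof.
move=> an /finite_seqP[s0 sE].
(* Adding 0 makes the polynomial nonconstant without having to show first that
   the spectrum of a is nonempty. *)
pose s := undup (0 :: s0).
have s_neq0 : s != [::].
  apply/eqP => s0E; have : 0 \in s by rewrite mem_undup mem_head.
  by rewrite s0E.
exists s; split => //; first exact: undup_uniq.
set P := \prod_(l <- s) _; set w := horner_alg a P.
have saw : GRing.comm (star a) w by apply: comm_horner_alg; exact: commr_sym.
have wn : normal_elt w.
  apply: commr_sym; apply: comm_horner_alg.
  by have := congr1 (@star _ A) saw; rewrite !starM starK.
apply: normal_root_null_eq0 => //; apply: spectrum_sub0_root_null => z.
move=> /spectrum_horner_alg[|l al <-].
  by rewrite size_prod_XsubC ltnS; case: (s) s_neq0.
apply/rootP; rewrite root_prod_XsubC mem_undup in_cons.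
by move: al; rewrite sE/= => ->; rewrite orbT.
Qed.

(** * Commutation with an element whose distance is zero *)

(** Put X = l - b and Y = b - m, commuting elements with sum the scalar l - m.
In the binomial expansion of (l - m)^N p b q every term contains p X^(N-i) and
Y^i q, hence is bounded by a constant times e^N; the 2^N terms, counted with
multiplicity, add up to at most (2 e)^N times this constant. With e a quarter of
|l - m|, dividing by |l - m|^N leaves 2^-N. *)
Lemma root_null_mulr_eq0 (R : realType) (A : banachAlg R[i]) (p q b : A)
    (l m : R[i]) : l != m ->
  root_null (fun n => p * (l%:A - b) ^+ n) ->
  root_null (fun n => (b - m%:A) ^+ n * q) ->
  p * b * q = 0.
Proof.
move=> lm /root_nullP pnull /root_nullP qnull.
set X := l%:A - b in pnull; set Y := b - m%:A in qnull.
set d := nrm (l - m).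
have d0 : 0 < d by rewrite -ltcR nrmE normr_gt0 subr_eq0.
have e0 : 0 < d / 4 by rewrite divr_gt0.
have [C leC] := pnull _ e0; have [D leD] := qnull _ e0.
have C0 : 0 <= C.
  by have := leC 0%N; rewrite !expr0 !mulr1; apply: le_trans (nrm_ge0 _).
have D0 : 0 <= D.
  by have := leD 0%N; rewrite !expr0 mulr1; apply: le_trans (nrm_ge0 _).
have bX : GRing.comm b X.
  apply: commrB; last exact: commr_refl.
  by rewrite /GRing.comm mulr_algl mulr_algr.
have bY : GRing.comm b Y.
  apply: commrB; first exact: commr_refl.
  by rewrite /GRing.comm mulr_algl mulr_algr.
have XY : GRing.comm X Y.
  apply: commrB; first exact/commr_sym.
  by rewrite /GRing.comm mulr_algl mulr_algr.
have XYE : X + Y = (l - m)%:A by rewrite /X /Y addrA subrK scalerBl.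
have expand N : (l - m) ^+ N *: (p * b * q) =
    \sum_(i < N.+1) (p * X ^+ (N - i) * b * (Y ^+ i * q)) *+ 'C(N, i).
  have -> : (l - m) ^+ N *: (p * b * q) = p * (X + Y) ^+ N * b * q.
    by rewrite XYE exprZn expr1n mulr_algr -!scalerAl.
  rewrite (exprDn_comm _ XY) mulr_sumr !mulr_suml; apply: eq_bigr => i _.
  rewrite mulrnAr !mulrnAl; congr (_ *+ _).
  by rewrite !mulrA -(mulrA _ _ b) -(commrX i bY) !mulrA.
have bound N : nrm (p * b * q) <= (C * nrm b * D) * (1 / 2) ^+ N.
  have dN : 0 < d ^+ N by rewrite exprn_gt0.
  rewrite -(ler_pM2l dN).
  have -> : d ^+ N * nrm (p * b * q) = nrm ((l - m) ^+ N *: (p * b * q)).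
    rewrite nrmZ; congr (_ * _); apply: complexI.
    by rewrite nrmE normrX rmorphXn/= nrmE.
  rewrite expand; apply: le_trans (nrm_sum _ _) _.
  apply: (@le_trans _ _ (\sum_(i < N.+1)
      ((C * nrm b * D) * (d / 4) ^+ N) *+ 'C(N, i))).
    apply: ler_sum => i _.
    have -> (w : A) k : nrm (w *+ k) = nrm w *+ k.
      by apply: complexI; rewrite nrmE normrMn -nrmE rmorphMn.
    rewrite lerMn2r; apply/orP; right.
    apply: (@le_trans _ _
      (C * (d / 4) ^+ (N - i) * nrm b * (D * (d / 4) ^+ i))).
      apply: le_trans (nrmM _ _) _; rewrite ler_pM ?nrm_ge0//.
      by apply: le_trans (nrmM _ _) _; rewrite ler_wpM2r ?nrm_ge0.
    have -> : (d / 4) ^+ N = (d / 4) ^+ (N - i) * (d / 4) ^+ i.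
      by rewrite -exprD subnK// -ltnS.
    by rewrite le_eqVlt; apply/orP; left; apply/eqP; ring.
  rewrite sumrMnr -(big_mkord xpredT (fun i => 'C(N, i)))/=.
  have -> : (\sum_(0 <= i < N.+1) 'C(N, i) = 2 ^ N)%N.
    rewrite big_mkord (expnDn 1 1).
    by apply: eq_bigr => i _; rewrite !exp1n !muln1.
  rewrite -[leLHS]mulr_natr natrX le_eqVlt; apply/orP; left; apply/eqP.
  rewrite -mulrA [RHS]mulrCA; congr (_ * _).
  by rewrite -!exprMn; congr (_ ^+ _); field.
apply/nrm_eq0/eqP; rewrite eq_le nrm_ge0 andbT.
apply/ler_addgt0Pr => e ee0; rewrite add0r.
set c := C * nrm b * D in bound.
have c0 : 0 <= c by rewrite !mulr_ge0 ?nrm_ge0.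
have : (fun n => (1 / 2 : R) ^+ n) @ \oo --> 0.
  by apply: cvg_expr; rewrite ger0_norm; lra.
move/cvgrPdist_le => /(_ (e / (c + 1))); rewrite divr_gt0//; last lra.
move=> /(_ isT) half; near \oo => N.
have : `|0 - (1 / 2 : R) ^+ N| <= e / (c + 1) by near: N.
have h0 : 0 <= (1 / 2 : R) ^+ N by apply: exprn_ge0; lra.
rewrite sub0r normrN ger0_norm// ler_pdivlMr; last lra.
move=> hN; apply: le_trans (bound N) _; rewrite mulrC; lra.
Unshelve. all: by end_near. Qed.

Section CommutatorIterates.
Variables (R : realType) (A : banachAlg R[i]).
Implicit Types a b p q : A.

Lemma mulr_iter_commutator a b p (l : R[i]) n : p * a = l *: p ->
  p * iter n (commutator_op a b) 1 = p * (l%:A - b) ^+ n.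
Proof.
move=> pa; elim: n => [|n IH] //=.
rewrite /commutator_op mulrBr mulrA pa mulrA -scalerAl IH exprSr.
by rewrite mulrA mulrBr mulr_algr.
Qed.

Lemma iter_commutator_mulr a b q (m : R[i]) n : a * q = m *: q ->
  iter n (commutator_op b a) 1 * q = (b - m%:A) ^+ n * q.
Proof.
move=> aq; elim: n => [|n IH] //=.
rewrite /commutator_op mulrBl -!mulrA aq -scalerAr IH exprS.
by rewrite -mulrA mulrBl mulr_algl.
Qed.

Lemma iter_commutator_comm a b n : GRing.comm a b ->
  iter n (commutator_op a b) 1 = (a - b) ^+ n.
Proof.
move=> ab; elim: n => [|n IH] //=; rewrite IH /commutator_op.
have -> : (a - b) ^+ n * b = b * (a - b) ^+ n.
  apply/esym/commrX/commrB; [exact: commr_sym|exact: commr_refl].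
by rewrite -mulrBl exprS.
Qed.

End CommutatorIterates.

(** Sandwiching a b - b a between p l and p m gives (l - m) (p l) b (p m), which
vanishes both for l = m and for l <> m. *)
Lemma root_null_comm (R : realType) (A : banachAlg R[i]) (a b : A)
    (s : seq R[i]) (p : R[i] -> A) :
  \sum_(l <- s) p l = 1 ->
  (forall l, l \in s -> a * p l = l *: p l /\ p l * a = l *: p l) ->
  root_null (fun n => iter n (commutator_op a b) 1) ->
  root_null (fun n => iter n (commutator_op b a) 1) ->
  GRing.comm a b.
Proof.
move=> p1 pE abnull banull; apply/eqP; rewrite -subr_eq0; apply/eqP.
rewrite -[LHS]mul1r -[LHS]mulr1 -p1 !mulr_suml big_seq big1// => l ls.
rewrite mulr_sumr big_seq big1// => m ms.
have [_ pla] := pE l ls; have [apm _] := pE m ms.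
rewrite mulrBr mulrBl !mulrA pla -(mulrA _ a) apm -scalerAr -!scalerAl.
rewrite -scalerBl; have [->|lm] := eqVneq l m; first by rewrite subrr scale0r.
rewrite (root_null_mulr_eq0 lm) ?scaler0//.
  rewrite (_ : (fun n => _) = fun n => p l * iter n (commutator_op a b) 1).
    exact: root_nullMl.
  by apply/funext => n; rewrite (mulr_iter_commutator _ _ pla).
rewrite (_ : (fun n => _) = fun n => iter n (commutator_op b a) 1 * p m).
  exact: root_nullMr.
by apply/funext => n; rewrite (iter_commutator_mulr _ _ apm).
Qed.

Theorem theorem5p1 (R : realType) (A : cstarAlg R[i]) (a b : A)
  (ha : normal_elt a) (hfin : finite_set (spectrum a)) :
  dist_ab a b = 0%E <-> quasinilpotent (a - b) /\ GRing.comm a b.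
Proof.
rewrite dist_ab_eq0 quasinilpotentP.
split=> [[abnull banull]|[null ab]].
  have ab : GRing.comm a b.
    have [s [us s0 aP]] := normal_finite_spectrum_annul ha hfin.
    have [p [p1 pE]] := annulled_spectral_resolution us s0 aP.
    exact: root_null_comm p1 pE abnull banull.
  split => // e e0; apply: filterS (abnull e e0) => n.
  by rewrite iter_commutator_comm.
split=> e e0; apply: filterS (null e e0) => n.
  by rewrite iter_commutator_comm.
rewrite iter_commutator_comm; last exact: commr_sym.
by rewrite -opprB exprNn -signr_odd mulr_sign; case: ifP => _; rewrite ?nrmN.
Qed.
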